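(* Let $p>3$ be a prime, $a\in\mathbb Z_p$ with $a\not\equiv0,-1,-2\pmod p$, and $a'=(a-\langle a\rangle_p)/p$. Then $$\sum_{k=0}^{p-2}\binom ak\binom{-1-a}k\binom{2k}k\frac1{4^k(k+1)^2}\equiv2S_p(a)+\frac{2a^2+2a-1}{a^2}S_p(a+1)+\frac{4a^3+6a^2-3a+2}{a^3(a+1)(a+2)}a'(a'+1)p^3\pmod{p^4}.$$
   Context: For a prime $p$, $\mathbb Z_p$ denotes the set of rational numbers whose denominator is not divisible by $p$, and congruences modulo powers of $p$ are between elements of $\mathbb Z_p$ (the difference divided by that power of $p$ lies in $\mathbb Z_p$). For $a\in\mathbb Z_p$, $\langle a\rangle_p\in\{0,1,\ldots,p-1\}$ is determined by $a\equiv\langle a\rangle_p\pmod p$. For rational $a$ and integer $k\ge0$, $\binom ak=a(a-1)\cdots(a-k+1)/k!$. Define $S_n(a)=\sum_{k=0}^{n-1}\binom ak\binom{-1-a}k\binom{2k}k\frac1{4^k}$ for $n\ge1$. *)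

(* Defs.v *)
From mathcomp Require Import all_boot all_order all_algebra.

Set Implicit Arguments.
Unset Strict Implicit.
Unset Printing Implicit Defensive.

Import Order.TTheory GRing.Theory Num.Theory.
Local Open Scope ring_scope.

(* Not the ring 'Z_p of integers mod p: this is Z localized at the prime p. *)
Definition pint (p : nat) : {pred rat} :=
  [pred x : rat | ~~ (p%:Z %| denq x)%Z].

(* The congruence of x and y modulo p ^ m in Z localized at p. *)
Definition pcong (p m : nat) (x y : rat) : bool :=
  (x - y) / p%:R ^+ m \in pint p.

(* <a>_p; the search succeeds for p prime and a p-integral, see presP. *)
Definition pres (p : nat) (a : rat) : nat :=
  find (fun r : nat => pcong p 1 a r%:R) (iota 0 p).

Definition gbinom (a : rat) (k : nat) : rat :=
  (\prod_(i < k) (a - i%:R)) / k`!%:R.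

Definition Ssum (n : nat) (a : rat) : rat :=
  \sum_(k < n) gbinom a k * gbinom (-1 - a) k * 'C(2 * k, k)%:R / 4%:R ^+ k.

Lemma pint_frac (p : nat) (n d : int) :
  d != 0 -> ~~ (p%:Z %| d)%Z -> n%:Q / d%:Q \in pint p.
Proof.
move=> d0 pd; rewrite inE; apply: contra pd => /dvdz_trans; apply.
set x := n%:Q / d%:Q.
have dQ : d%:Q != 0 by rewrite intr_eq0.
have xE : x * d%:Q = n%:Q by rewrite /x divfK.
have : numq x * d = n * denq x.
  by apply: (@intr_inj rat); rewrite !rmorphM /= numqE -xE mulrAC.
move=> e; have : (denq x %| numq x * d)%Z by rewrite e dvdz_mull.
by rewrite Gauss_dvdzr // coprimezE coprime_sym coprime_num_den.
Qed.

Lemma presP (p : nat) (a : rat) : prime p -> a \in pint p ->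
  (pres p a < p)%N /\ pcong p 1 a (pres p a)%:R.
Proof.
move=> pp; rewrite inE => ap.
suff hs : has (fun r : nat => pcong p 1 a r%:R) (iota 0 p).
  have lt : (pres p a < p)%N by move: hs; rewrite has_find size_iota.
  split=> //; have := nth_find 0%N hs.
  by rewrite -/(pres p a) nth_iota.
have p0 : p%:Z != 0 by rewrite eqz_nat -lt0n prime_gt0.
have cop : coprimez p%:Z (denq a).
  by rewrite coprimezE /= prime_coprime //; rewrite dvdzE in ap.
have [[u v] /= uv] := coprimezP _ _ cop.
pose m := numq a * v; pose r := `|(m %% p%:Z)%Z|%N.
have rE : r%:Z = (m %% p%:Z)%Z by rewrite /r gez0_abs // modz_ge0.
apply/hasP; exists r.
  by rewrite mem_iota add0n /= -ltz_nat rE ltz_pmod // ltz_nat prime_gt0.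
have dQ : (denq a)%:Q != 0 by rewrite intr_eq0 denq_neq0.
have pQ : p%:R != 0 :> rat by rewrite pnatr_eq0 -lt0n prime_gt0.
rewrite /pcong expr1.
suff -> : (a - r%:R) / p%:R
        = (numq a * u + (m %/ p%:Z)%Z * denq a)%:Q / (denq a)%:Q.
  by apply: pint_frac; rewrite ?denq_neq0.
apply/eqP; rewrite eqr_div // mulrBl -numqE.
rewrite -[r%:R]/(r%:Z%:~R) -[p%:R]/(p%:Z%:~R) -!(intrM, intrB) eqr_int.
have -> : r%:Z = m - (m %/ p%:Z)%Z * p%:Z.
  by rewrite {1}(divz_eq m p%:Z) addrC addKr rE.
apply/eqP; rewrite mulrBl mulrDl opprB addrCA addrC; congr (_ + _).
  by rewrite /m -!mulrA -{1}[numq a]mulr1 -uv mulrDr addrK.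
by rewrite mulrAC.
Qed.

(* Main.v *)
(* Put u_k = C(a+1,k) C(-1-a,k) C(2k,k) / 4^k.  The summands of S_n(a) and of
   S_n(a+1) are (a+1-k)/(a+1) u_k and (a+1+k)/(a+1) u_k, and Gosper summation
   turns the left-hand side, cut at any n, into
     2 S_n(a) + (2a^2+2a-1)/a^2 S_n(a+1) + 2n((2a-1)n+a)/(a^2(a+1)) u_n.
   At n = p-1 all that is left is a multiple of u_{p-1}, which has a factor
   p^3; the cofactor is determined mod p by C(r+pb,p) = b mod p (0 <= r < p),
   applied to a, to -1-a and to 2p-1. *)
Require Import Defs.
From mathcomp Require Import all_boot all_order all_algebra.
From mathcomp Require Import ring zify.

Set Implicit Arguments.
Unset Strict Implicit.
Unset Printing Implicit Defensive.

Import Order.TTheory GRing.Theory Num.Theory.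
Local Open Scope ring_scope.

(** * Recurrences for the binomials and for u_k *)

Lemma gbinom0 (a : rat) : gbinom a 0 = 1.
Proof. by rewrite /gbinom big_ord0 fact0 divr1. Qed.

Lemma gbinomS (a : rat) (k : nat) :
  gbinom a k.+1 = gbinom a k * (a - k%:R) / (k%:R + 1).
Proof.
rewrite /gbinom big_ord_recr /= factS natrM natr1 invfM.
by rewrite -!mulrA; congr (_ * _); rewrite [RHS]mulrC !mulrA mulrAC.
Qed.

(** Both sides are (a+1)a(a-1)...(a-k+1)/k!. The form without division stays usable when a+1 or
    a+1-k vanishes. *)
Lemma gbinom_shift (a : rat) (k : nat) :
  (a + 1) * gbinom a k = (a + 1 - k%:R) * gbinom (a + 1) k.
Proof.
elim: k => [|k IHk]; first by rewrite !gbinom0 subr0.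
have k0 : k%:R + 1 != 0 :> rat by rewrite natr1 pnatr_eq0.
rewrite !gbinomS mulrA mulrA IHk -natr1; field; exact: k0.
Qed.

Lemma gbinom_nat (n k : nat) : gbinom n%:R k = 'C(n, k)%:R.
Proof.
elim: k => [|k IHk]; first by rewrite gbinom0 bin0.
rewrite gbinomS IHk natr1.
have k0 : k.+1%:R != 0 :> rat by rewrite pnatr_eq0.
apply: (canLR (mulfK k0)); rewrite -natrM mulnC mul_bin_left natrM mulrC.
case: (leqP k n) => [kn|nk]; first by rewrite natrB.
by rewrite bin_small // !mulr0.
Qed.

Lemma central_binS (k : nat) : 'C(2 * k.+1, k.+1)%:R
  = 'C(2 * k, k)%:R * (2%:R * (2%:R * k%:R + 1)) / (k%:R + 1) :> rat.
Proof.
have k0 : k.+1%:R != 0 :> rat by rewrite pnatr_eq0.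
rewrite natr1; apply: (canRL (mulfK k0)).
suff e : ('C(2 * k.+1, k.+1) * k.+1 = 'C(2 * k, k) * (2 * (2 * k).+1))%N.
  by rewrite -[LHS]natrM e !natrM -(natr1 (2 * k)%N) natrM.
(* Two absorption identities meet at C(2k+1,k). *)
have e1 := mul_bin_diag (2 * k.+1) k; have e2 := mul_bin_down (2 * k).+1 k.
have e3 : ((2 * k).+1 - k = k.+1)%N by lia.
have e4 : ((2 * k.+1).-1 = (2 * k).+1)%N by lia.
rewrite e3 /= in e2; rewrite e4 in e1.
by rewrite mulnC -e1 -mulnA -e2; lia.
Qed.

(** The summands of S_n(a) and S_n(a+1) have upper arguments a, -1-a and a+1, -2-a. Taking the
    larger of each pair makes both summands multiples of one term, with factors polynomial in k. *)
Definition uterm (a : rat) (k : nat) : rat :=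
  gbinom (a + 1) k * gbinom (-1 - a) k * 'C(2 * k, k)%:R / 4%:R ^+ k.

Lemma utermS (a : rat) (k : nat) :
  uterm a k.+1 = uterm a k * (k%:R - a - 1) * (k%:R + a + 1) * (2%:R * k%:R + 1)
    / (2%:R * (k%:R + 1) ^+ 3).
Proof.
have k0 : k%:R + 1 != 0 :> rat by rewrite natr1 pnatr_eq0.
have f0 : 4%:R ^+ k != 0 :> rat by rewrite expf_neq0.
rewrite /uterm !gbinomS central_binS exprS.
by field; rewrite k0 f0.
Qed.

Lemma Sterm_uterm (a : rat) (k : nat) : a + 1 != 0 ->
  gbinom a k * gbinom (-1 - a) k * 'C(2 * k, k)%:R / 4%:R ^+ k
  = (a + 1 - k%:R) / (a + 1) * uterm a k.
Proof.
move=> a1; rewrite /uterm.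
have -> : gbinom a k = (a + 1 - k%:R) / (a + 1) * gbinom (a + 1) k.
  by rewrite mulrAC -gbinom_shift mulrAC divff // mul1r.
by rewrite !mulrA.
Qed.

(** Here it is the second binomial that moves: the shift rule raises its upper argument from -2-a to
    -1-a. *)
Lemma Sterm_succ_uterm (a : rat) (k : nat) : a + 1 != 0 ->
  gbinom (a + 1) k * gbinom (-1 - (a + 1)) k * 'C(2 * k, k)%:R / 4%:R ^+ k
  = (a + 1 + k%:R) / (a + 1) * uterm a k.
Proof.
move=> a1; rewrite /uterm.
have -> : gbinom (-1 - (a + 1)) k
        = (a + 1 + k%:R) / (a + 1) * gbinom (-1 - a) k.
  have e := gbinom_shift (-1 - (a + 1)) k.
  have aE : -1 - (a + 1) + 1 = -1 - a by ring.
  rewrite aE in e; rewrite mulrAC; apply: (canRL (mulfK a1)).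
  have -> : gbinom (-1 - (a + 1)) k * (a + 1)
          = - ((-1 - a) * gbinom (-1 - (a + 1)) k) by ring.
  by rewrite e; ring.
ring.
Qed.

(** * Gosper summation of the left-hand side *)

Lemma Ssum_recr (n : nat) (a : rat) : Ssum n.+1 a = Ssum n a
  + gbinom a n * gbinom (-1 - a) n * 'C(2 * n, n)%:R / 4%:R ^+ n.
Proof. by rewrite /Ssum big_ord_recr. Qed.

(* The last summand is the Gosper certificate; writing it with [uterm] rather
   than with the summand of [Ssum n a] avoids a division by [a + 1 - n]. *)
Lemma sum_div_sqr (a : rat) (n : nat) : a != 0 -> a + 1 != 0 ->
  \sum_(k < n) gbinom a k * gbinom (-1 - a) k * 'C(2 * k, k)%:R
     / (4%:R ^+ k * (k%:R + 1) ^+ 2)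
  = 2%:R * Ssum n a
    + (2%:R * a ^+ 2 + 2%:R * a - 1) / a ^+ 2 * Ssum n (a + 1)
    + 2%:R * n%:R * ((2%:R * a - 1) * n%:R + a) / (a ^+ 2 * (a + 1))
      * uterm a n.
Proof.
move=> a0 a1; elim: n => [|n IHn].
  by rewrite /Ssum !big_ord0 !mulr0 !mul0r !addr0.
have k0 : n%:R + 1 != 0 :> rat by rewrite natr1 pnatr_eq0.
(* All new terms become rational multiples of u_n, so the induction step is an identity of rational
   functions in a and n. *)
rewrite big_ord_recr /= IHn !Ssum_recr Sterm_succ_uterm // utermS.
rewrite [(4%:R ^+ n * _)^-1]invfM [X in _ + X = _]mulrA Sterm_uterm //.
rewrite -[n.+1%:R]natr1.
by field; rewrite a0 a1 k0.
Qed.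

(** * Units and congruences modulo p in Z localized at p *)

Section LocalIntegers.

Variables (p : nat) (p_prime : prime p).

(** Fractions need not be reduced here, so sums and products can be formed over the product of the
    denominators. *)
Lemma pintP (x : rat) :
  reflect (exists2 nd : int * int, ~~ (p%:Z %| nd.2)%Z & x = nd.1%:Q / nd.2%:Q)
    (x \in pint p).
Proof.
apply: (iffP idP) => [xp|[[n d] /= pd ->]].
  by exists (numq x, denq x) => //=; rewrite divq_num_den.
by apply: pint_frac => //; apply: contraNneq pd => ->; rewrite dvdz0.
Qed.

Lemma Euclid_dvdzM (m n : int) :
  (p%:Z %| m * n)%Z = (p%:Z %| m)%Z || (p%:Z %| n)%Z.
Proof. by rewrite !dvdzE abszM Euclid_dvdM. Qed.

Lemma pint_int (m : int) : m%:~R \in pint p.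
Proof.
apply/pintP; exists (m, 1); last by rewrite /= divr1.
by rewrite dvdzE /= dvdn1 neq_ltn prime_gt1 ?orbT.
Qed.

Lemma pint_nat (n : nat) : n%:R \in pint p.
Proof. exact: (pint_int n%:Z). Qed.

Lemma denomM_neq0 (m n : int) : ~~ (p%:Z %| m)%Z -> ~~ (p%:Z %| n)%Z ->
  [/\ m%:Q != 0, n%:Q != 0 & ~~ (p%:Z %| m * n)%Z].
Proof.
move=> pm pn; rewrite !intr_eq0 Euclid_dvdzM negb_or pm pn.
by split=> //; [apply: contraNneq pm | apply: contraNneq pn] => ->;
  rewrite dvdz0.
Qed.

Lemma pintM (x y : rat) : x \in pint p -> y \in pint p -> x * y \in pint p.
Proof.
move=> /pintP[[n d] /= pd ->] /pintP[[m e] /= pe ->].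
have [d0 e0 pde] := denomM_neq0 pd pe.
by apply/pintP; exists (n * m, d * e); rewrite //= !rmorphM mulf_div.
Qed.

Lemma pintD (x y : rat) : x \in pint p -> y \in pint p -> x + y \in pint p.
Proof.
move=> /pintP[[n d] /= pd ->] /pintP[[m e] /= pe ->].
have [d0 e0 pde] := denomM_neq0 pd pe.
apply/pintP; exists (n * e + m * d, d * e) => //=.
by rewrite rmorphD !rmorphM addf_div.
Qed.

Lemma pintN (x : rat) : x \in pint p -> - x \in pint p.
Proof. by rewrite -mulN1r; apply: pintM; exact: (pint_int (-1)). Qed.

Lemma pintB (x y : rat) : x \in pint p -> y \in pint p -> x - y \in pint p.
Proof. by move=> xp yp; rewrite pintD ?pintN. Qed.

Lemma pintX (x : rat) (n : nat) : x \in pint p -> x ^+ n \in pint p.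
Proof.
move=> xp; elim: n => [|n IHn]; first exact: (pint_nat 1).
by rewrite exprS pintM.
Qed.

Lemma prime_natr_neq0 : p%:R != 0 :> rat.
Proof. by rewrite pnatr_eq0 -lt0n prime_gt0. Qed.

(** Integrality of both sides is bundled in because [pcong] bounds only the difference, which is not
    enough for products. *)
Definition pcong_int (x y : rat) :=
  [/\ x \in pint p, y \in pint p & pcong p 1 x y].

(** Since 0^-1 = 0 in [rat], integrality of x and x^-1 alone would admit 0. *)
Definition punit (x : rat) := [/\ x != 0, x \in pint p & x^-1 \in pint p].

Lemma punit_ncong0 (x : rat) :
  x \in pint p -> ~~ pcong p 1 x 0 -> punit x.
Proof.
move=> xp; rewrite /pcong subr0 expr1 => xn; split=> //.
  by apply: contraNneq xn => ->; rewrite mul0r (pint_nat 0).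
case/pintP: xp xn => -[n d] /= pd -> xn.
rewrite invf_div; apply/pintP; exists (d, n) => //=.
apply: contra xn => /dvdzP[m ->].
rewrite rmorphM /= mulrAC mulfK ?prime_natr_neq0 //.
by apply/pintP; exists (m, d).
Qed.

Lemma punitM (x y : rat) : punit x -> punit y -> punit (x * y).
Proof.
by move=> [x0 xp xv] [y0 yp yv]; split; rewrite ?mulf_neq0 ?invfM ?pintM.
Qed.

Lemma punit1 : punit 1.
Proof. by split; rewrite ?invr1 ?(pint_nat 1). Qed.

Lemma punit_nat (n : nat) : ~~ (p %| n)%N -> punit n%:R.
Proof.
move=> pn; split; last 1 first.
- apply/pintP; exists (1, n%:Z); rewrite /= ?div1r //; by rewrite dvdzE.
- by rewrite pnatr_eq0; apply: contraNneq pn => ->; rewrite dvdn0.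
- exact: pint_nat.
Qed.

Lemma pcong_refl (x : rat) : x \in pint p -> pcong_int x x.
Proof. by split=> //; rewrite /pcong subrr mul0r (pint_nat 0). Qed.

Lemma pcong_sym (x y : rat) : pcong_int x y -> pcong_int y x.
Proof.
by move=> [xp yp c]; split=> //; rewrite /pcong -opprB mulNr pintN.
Qed.

Lemma pcong_trans (x y z : rat) :
  pcong_int x y -> pcong_int y z -> pcong_int x z.
Proof.
move=> [xp yp c] [_ zp c']; split=> //.
by rewrite /pcong -(subrKA y) mulrDl pintD.
Qed.

Lemma pcong_prime0 : pcong_int p%:R 0.
Proof.
split; [exact: pint_nat | exact: (pint_nat 0) |].
by rewrite /pcong subr0 expr1 divff ?prime_natr_neq0 // (pint_nat 1).
Qed.

Lemma pcongD (x y x' y' : rat) :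
  pcong_int x y -> pcong_int x' y' -> pcong_int (x + x') (y + y').
Proof.
move=> [xp yp c] [xp' yp' c']; split; rewrite ?pintD //.
by rewrite /pcong opprD addrACA mulrDl pintD.
Qed.

Lemma pcongM (x y x' y' : rat) :
  pcong_int x y -> pcong_int x' y' -> pcong_int (x * x') (y * y').
Proof.
move=> [xp yp c] [xp' yp' c']; split; rewrite ?pintM // /pcong.
have -> : x * x' - y * y' = x * (x' - y') + (x - y) * y' by ring.
by rewrite mulrDl -mulrA [_ * y' / _]mulrAC pintD // pintM.
Qed.

Lemma pcongN (x y : rat) : pcong_int x y -> pcong_int (- x) (- y).
Proof.
move=> [xp yp c]; split; rewrite ?pintN //.
by rewrite /pcong -opprD mulNr pintN.
Qed.

Lemma pcongB (x y x' y' : rat) :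
  pcong_int x y -> pcong_int x' y' -> pcong_int (x - x') (y - y').
Proof. by move=> c c'; apply/pcongD/pcongN. Qed.

(** If p divided x, it would divide y = x - (x - y), and multiplying by y^-1 would make 1/p
    p-integral. *)
Lemma pcong_punit (x y : rat) : pcong_int x y -> punit y -> punit x.
Proof.
move=> [xp yp c] [y0 _ yv]; apply: punit_ncong0 => //.
apply/negP; rewrite /pcong subr0 expr1 => xc.
have : 1 / p%:R \in pint p.
  have -> : 1 / p%:R = (x / p%:R - (x - y) / p%:R) * y^-1 :> rat.
    by field; rewrite y0 prime_natr_neq0.
  by rewrite pintM // pintB.
case/pintP=> -[n d] /= pd /eqP.
have d0 : d%:Q != 0.
  by rewrite intr_eq0; apply: contraNneq pd => ->; rewrite dvdz0.
rewrite eqr_div ?prime_natr_neq0 // mul1r -[p%:R]/(p%:Z%:~R) -intrM eqr_int.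
by move=> /eqP de; rewrite de dvdz_mull in pd.
Qed.

Lemma pcongV (x y : rat) :
  pcong_int x y -> punit y -> pcong_int x^-1 y^-1.
Proof.
move=> c uy; have [x0 _ xv] := pcong_punit c uy.
case: uy c => y0 _ yv [_ _ c]; split; rewrite // /pcong.
have -> : x^-1 - y^-1 = - (x - y) * (x^-1 * y^-1) by field; rewrite x0 y0.
by rewrite mulrAC mulNr pintM ?pintM ?pintN.
Qed.

Lemma pcong_prod (n : nat) (f g : nat -> rat) :
  (forall i, (i < n)%N -> pcong_int (f i) (g i)) ->
  pcong_int (\prod_(i < n) f i) (\prod_(i < n) g i).
Proof.
move=> fg; apply: (big_ind2 pcong_int); first exact: pcong_refl (pint_nat 1).
  by move=> x1 x2 y1 y2; apply: pcongM.
by move=> i _; apply: fg.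
Qed.

Lemma punit_fact (n : nat) : (n < p)%N -> punit n`!%:R.
Proof.
move=> np; apply: punit_nat; elim: n np => [|n IHn] np.
  by rewrite fact0 dvdn1 neq_ltn prime_gt1 ?orbT.
by rewrite factS Euclid_dvdM // negb_or IHn 1?ltnW // andbT gtnNdvd.
Qed.

(* Of the p factors of the numerator, the one of index r is pb and the others
   run over all nonzero residues. *)
Lemma gbinom_prime (r : nat) (b : rat) : (r < p)%N -> b \in pint p ->
  pcong_int (gbinom (r%:R + p%:R * b) p) b.
Proof.
move=> rp bp; set a := r%:R + _.
have pS : p = (r + (p - r.+1).+1)%N by rewrite addnS -addSn subnKC.
have pb0 : pcong_int (p%:R * b) 0.
  by rewrite -(mul0r b); apply: pcongM pcong_prime0 (pcong_refl bp).
set m := (p - r.+1)%N.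
(* The product is cut at i = r, where the factor is pb; the factor of index r+1+j is pb - (j+1). *)
have prodE : \prod_(i < p) (a - i%:R) = p%:R
    * (b * (\prod_(i < r) (a - i%:R) * \prod_(i < m) (p%:R * b - i.+1%:R))).
  have -> : \prod_(i < p) (a - i%:R) = \prod_(0 <= i < r + m.+1) (a - i%:R).
    by rewrite -pS big_mkord.
  rewrite (@big_cat_nat _ _ _ r) ?leq_addr //= big_mkord.
  rewrite -[X in \prod_(X <= _ < _) _]add0n big_addn addKn big_mkord.
  rewrite big_ord_recl /= add0n addrAC subrr add0r.
  rewrite (eq_bigr (fun i : 'I_m => p%:R * b - i.+1%:R)); first by ring.
  by move=> i _; rewrite /bump /= add1n natrD /a; ring.
(* p! = p (p-1)! is cut in the same shape, as r! times the m largest factors of (p-1)!, so that [A]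
   and [B] are congruent factor by factor. *)
have factE : p`!%:R = p%:R
    * (\prod_(i < r) (r%:R - i%:R) * \prod_(i < m) (p%:R - i.+1%:R)) :> rat.
  rewrite -[p in p`!](prednK (prime_gt0 p_prime)) factS.
  rewrite prednK ?prime_gt0 // natrM.
  congr (_ * _).
  have mp : (m <= p.-1)%N by rewrite /m; lia.
  rewrite -(ffact_fact mp) natrM mulrC; congr (_ * _).
    have -> : (p.-1 - m = r)%N by rewrite /m; lia.
    rewrite -ffactnn ffact_prod natr_prod; apply: eq_bigr => i _.
    by rewrite natrB // ltnW.
  rewrite ffact_prod natr_prod; apply: eq_bigr => i _.
  have ip : (i.+1 <= p)%N by have := ltn_ord i; rewrite /m; lia.
  by rewrite -natrB //; congr _%:R; lia.
set A := (X in p%:R * (b * X)) in prodE.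
set B := (X in p%:R * X) in factE.
have p0 := prime_natr_neq0.
have uB : punit B.
  have -> : B = p.-1`!%:R.
    apply: (mulfI p0); rewrite -factE -natrM.
    by rewrite -[p in LHS](prednK (prime_gt0 p_prime)) factS prednK ?prime_gt0.
  by apply: punit_fact; rewrite prednK ?prime_gt0.
have AB : pcong_int A B.
  apply: pcongM.
    apply: (pcong_prod (f := fun i => a - i%:R) (g := fun i => r%:R - i%:R)).
    move=> i _; apply: pcongB; last exact/pcong_refl/pint_nat.
    rewrite -[X in pcong_int _ X]addr0.
    by apply: pcongD pb0; exact/pcong_refl/pint_nat.
  apply: (pcong_prod (f := fun i => p%:R * b - i.+1%:R)
    (g := fun i => p%:R - i.+1%:R)).
  move=> i _; apply: pcongB; last exact/pcong_refl/pint_nat.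
  exact: pcong_trans pb0 (pcong_sym pcong_prime0).
have [B0 _ Bv] := uB.
have -> : gbinom a p = b * A / B.
  by rewrite /gbinom prodE factE; field; rewrite p0 B0.
rewrite -[b in X in pcong_int _ X](mulfK B0).
exact: pcongM (pcongM (pcong_refl bp) AB) (pcong_refl Bv).
Qed.

End LocalIntegers.

(** * The value u_{p-1} and its factor p^3 *)

Lemma pcong_expn_pred (p n : nat) : prime p -> ~~ (p %| n)%N ->
  pcong_int p (n%:R ^+ p.-1) 1.
Proof.
move=> pp pn; have un := punit_nat pp pn; have [n0 np nv] := un.
suff c : pcong_int p (n%:R ^+ p) n%:R.
  have := pcongM pp c (pcong_refl pp nv).
  by rewrite divff // -[p in _ ^+ p](prednK (prime_gt0 pp)) exprSr mulfK.
split; [exact: pintX | by [] |].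
have e := fermat_little n pp.
(* Since n^p and n have the same remainder, their difference is p times the difference of the
   quotients. *)
rewrite /pcong expr1 -natrX (divn_eq (n ^ p) p) e [X in _ - X%:R](divn_eq n p).
rewrite !natrD opprD addrACA subrr addr0 !natrM -mulrBl mulfK ?prime_natr_neq0 //.
exact: pintB (pint_nat _ _) (pint_nat _ _).
Qed.

(** Absorption gives (2p-1) C(2p-2,p-1) = p C(2p-1,p). Writing 2p-1 as (p-1) + p*1 prepares
    [gbinom_prime] with r = p-1 and b = 1. *)
Lemma central_bin_pred (p : nat) : prime p ->
  'C(2 * p.-1, p.-1)%:R
  = p%:R * gbinom (p.-1%:R + p%:R * 1) p / (2%:R * p%:R - 1) :> rat.
Proof.
move=> pp; rewrite mulr1 -natrD gbinom_nat.
have pS := prednK (prime_gt0 pp).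
have e := mul_bin_diag (p.-1 + p) p.-1.
have e1 : ((p.-1 + p).-1 = 2 * p.-1)%N by rewrite -{2}pS; lia.
rewrite e1 pS in e; rewrite -natrM -e.
have -> : 2%:R * p%:R - 1 = (p.-1 + p)%:R :> rat.
  by rewrite natrD -subn1 natrB ?prime_gt0 //; ring.
by rewrite natrM mulrAC divff ?mul1r // pnatr_eq0 -pS; lia.
Qed.

(** Each of the three binomials of lower index p-1 is traded for one of lower index p, at the cost
    of a factor p. The signs of -(a+p) and 2p-1 cancel. *)
Lemma uterm_pred (p : nat) (a : rat) (P := p%:R) : prime p ->
  a + 1 - P != 0 -> a + 2%:R - P != 0 -> a + P != 0 ->
  uterm a p.-1 = P ^+ 3 * (a + 1)
    * (gbinom a p * gbinom (-1 - a) p * gbinom (p.-1%:R + P * 1) p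
       / (1 - 2%:R * P) / 4%:R ^+ p.-1
       / ((a + 1 - P) * (a + 2%:R - P) * (a + P))).
Proof.
move=> pp h1 h2 h3; rewrite /uterm central_bin_pred //.
have pS := prednK (prime_gt0 pp); have P0 : P != 0 := prime_natr_neq0 pp.
have P1 : p.-1%:R = P - 1 :> rat by rewrite /P -[in RHS]pS -natr1 addrK.
have rec c : P * gbinom c p = gbinom c p.-1 * (c + 1 - P).
  by rewrite -[p in gbinom c p]pS gbinomS P1; field; rewrite subrK.
have F0 : 4%:R ^+ p.-1 != 0 :> rat by rewrite expf_neq0.
have Q0 : 1 - 2%:R * P != 0.
  by rewrite /P -natrM subr_eq0 -[1]/(1%:R) eqr_nat -pS; lia.
have Q1 : 2%:R * P - 1 != 0 by rewrite -opprB oppr_eq0.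
have eB : gbinom (-1 - a) p.-1 = P * gbinom (-1 - a) p / - (a + P).
  by rewrite rec; field.
have eA : gbinom (a + 1) p.-1
    = P * (a + 1) * gbinom a p / ((a + 1 - P) * (a + 2%:R - P)).
  have -> : P * (a + 1) * gbinom a p = (a + 1 - P) * ((a + 1) * gbinom a p.-1).
    by rewrite mulrAC rec; ring.
  by rewrite gbinom_shift P1; field; rewrite h1 h2.
by rewrite eA eB; field; rewrite h1 h2 h3 Q0 Q1 F0.
Qed.

(** * Assembly of the congruence modulo p^4 *)

Theorem theorem9p1 (p : nat) (a : rat)
    (p_prime : prime p) (p_gt3 : (3 < p)%N) (a_int : a \in pint p)
    (a_n0 : ~~ pcong p 1 a 0) (a_nN1 : ~~ pcong p 1 a (-1))
    (a_nN2 : ~~ pcong p 1 a (- 2%:R)) :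
  let a' : rat := (a - (pres p a)%:R) / p%:R in
  pcong p 4
    (\sum_(k < p.-1) gbinom a k * gbinom (-1 - a) k * 'C(2 * k, k)%:R
       / (4%:R ^+ k * (k%:R + 1) ^+ 2))
    (2%:R * Ssum p a
     + (2%:R * a ^+ 2 + 2%:R * a - 1) / a ^+ 2 * Ssum p (a + 1)
     + (4%:R * a ^+ 3 + 6%:R * a ^+ 2 - 3%:R * a + 2%:R)
         / (a ^+ 3 * (a + 1) * (a + 2%:R)) * a' * (a' + 1) * p%:R ^+ 3).
Proof.
cbv zeta; set r := pres p a; set a' := (a - r%:R) / p%:R.
have [rp] := presP p_prime a_int; rewrite /pcong expr1 -/r -/a' => a'p.
have p0 := prime_natr_neq0 p_prime.
have pS := prednK (prime_gt0 p_prime).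
have p1 : p.-1%:R = p%:R - 1 :> rat by rewrite -[in RHS]pS -natr1 addrK.
have aE : a = r%:R + p%:R * a' by rewrite /a'; field.
(* The residue of -1-a is p-1-r, which leaves the quotient -1-a'; their product yields a'(a'+1) up
   to sign. *)
have bE : -1 - a = (p.-1 - r)%N%:R + p%:R * (-1 - a').
  have rp' : (r <= p.-1)%N by lia.
  by rewrite natrB // p1 {1}aE; ring.
have refl := @pcong_refl p p_prime.
have n_int n : n%:R \in pint p by apply: pint_nat.
(* The three excluded residues make every denominator below a unit. *)
have [ua ua1 ua2] : [/\ punit p a, punit p (a + 1) & punit p (a + 2%:R)].
  split; apply: punit_ncong0 => //.
  - exact: pintD a_int (n_int 1).
  - by move: a_nN1; rewrite /pcong opprK [a + 1 - 0]subr0.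
  - exact: pintD a_int (n_int 2).
  - by move: a_nN2; rewrite /pcong opprK [a + 2%:R - 0]subr0.
have cp : pcong_int p p%:R 0 := pcong_prime0 p_prime.
have cA : pcong_int p (gbinom a p) a'.
  by rewrite [in gbinom _ _]aE; apply: gbinom_prime.
have cB : pcong_int p (gbinom (-1 - a) p) (-1 - a').
  rewrite bE; apply: gbinom_prime => //; first lia.
  exact: pintB (pint_int _ (-1)) _.
have cX : pcong_int p (gbinom (p.-1%:R + p%:R * 1) p) 1.
  by apply: gbinom_prime; rewrite ?(n_int 1) // prednK ?prime_gt0.
have cF : pcong_int p (4%:R ^+ p.-1) 1.
  apply: pcong_expn_pred => //.
  (* 4 is read as 2^2. *)
  rewrite (Euclid_dvdX 2 2 p_prime) gtnNdvd //; lia.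
have c1 : pcong_int p (a + 1 - p%:R) (a + 1).
  by rewrite -[X in pcong_int _ _ X]subr0; apply: pcongB => //; apply: refl;
    case: ua1.
have c2 : pcong_int p (a + 2%:R - p%:R) (a + 2%:R).
  by rewrite -[X in pcong_int _ _ X]subr0; apply: pcongB => //; apply: refl;
    case: ua2.
have c3 : pcong_int p (a + p%:R) a.
  by rewrite -[X in pcong_int _ _ X]addr0; apply: pcongD => //; apply: refl.
have [a0 _ ai] := ua; have [a10 _ _] := ua1; have [a20 _ _] := ua2.
have [d1 _ _] := pcong_punit p_prime c1 ua1.
have [d2 _ _] := pcong_punit p_prime c2 ua2.
have [d3 _ _] := pcong_punit p_prime c3 ua.
(* [W] is u_{p-1}/(p^3(a+1)) with p and each factor known mod p abstracted, so that it can be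
   evaluated at the residues too. *)
pose W P A B X F : rat := A * B * X / (1 - 2%:R * P) / F
  / ((a + 1 - P) * (a + 2%:R - P) * (a + P)).
(* [K] at p is the coefficient of u_{p-1}/(a+1): two terms from replacing S_{p-1} by S_p at a and at
   a+1, and the Gosper certificate at n = p-1. *)
pose K P : rat := - 2%:R * (a + 2%:R - P)
  - (2%:R * a ^+ 2 + 2%:R * a - 1) / a ^+ 2 * (a + P)
  + 2%:R * (P - 1) * ((2%:R * a - 1) * (P - 1) + a) / a ^+ 2.
pose Wp := W p%:R (gbinom a p) (gbinom (-1 - a) p)
  (gbinom (p.-1%:R + p%:R * 1) p) (4%:R ^+ p.-1).
pose W0 := W 0 a' (-1 - a') 1 1.
have [_ _ cWK] : pcong_int p (Wp * K p%:R) (W0 * K 0).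
  have i1 : 1 \in pint p := n_int 1.
  have i2 : a ^- 2 \in pint p by rewrite -exprVn pintX.
  have cQ : pcong_int p (1 - 2%:R * p%:R) (1 - 2%:R * 0).
    apply: pcongB (refl _ i1) _ => //.
    by apply: pcongM cp => //; apply/refl/n_int.
  have uQ : punit p (1 - 2%:R * 0).
    by rewrite mulr0 subr0; apply: punit1.
  have cD : pcong_int p ((a + 1 - p%:R) * (a + 2%:R - p%:R) * (a + p%:R))
      ((a + 1 - 0) * (a + 2%:R - 0) * (a + 0)).
    by rewrite !subr0 ?addr0; do 2?apply: pcongM.
  have uD : punit p ((a + 1 - 0) * (a + 2%:R - 0) * (a + 0)).
    by rewrite !subr0 ?addr0; do 2?apply: punitM.
  have c20 : pcong_int p (a + 2%:R - p%:R) (a + 2%:R - 0) by rewrite subr0.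
  have c30 : pcong_int p (a + p%:R) (a + 0) by rewrite addr0.
  have cp1 : pcong_int p (p%:R - 1) (0 - 1) by apply: pcongB => //; apply: refl.
  have cc : pcong_int p ((2%:R * a ^+ 2 + 2%:R * a - 1) / a ^+ 2)
      ((2%:R * a ^+ 2 + 2%:R * a - 1) / a ^+ 2).
    by apply: refl; rewrite pintM ?pintB ?pintD ?pintM ?pintX.
  have n2 : - 2%:R \in pint p by rewrite pintN.
  rewrite /Wp /W0 /W /K; apply: pcongM => //.
    by do ![apply: pcongM => // | apply: pcongV => // | exact: punit1].
  apply: pcongD => //; last first.
    apply: pcongM => //; last exact: refl.
    apply: pcongM => //; first by apply: pcongM => //; apply/refl/n_int.
    apply: pcongD => //; last exact: refl.
    by apply: pcongM => //; apply: refl; rewrite pintB ?pintM.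
  apply: pcongB => //; last exact: pcongM.
  by apply: pcongM => //; apply: refl.
(* Setting p = 0 gives a^2 K(0) = -(4a^3+6a^2-3a+2), the stated numerator up to sign. *)
have -> : (4%:R * a ^+ 3 + 6%:R * a ^+ 2 - 3%:R * a + 2%:R)
   / (a ^+ 3 * (a + 1) * (a + 2%:R)) * a' * (a' + 1) = W0 * K 0.
  by rewrite /W0 /W /K; field; rewrite a0 a10 a20.
(* The two sides differ by p^3 (Wp K(p) - W0 K(0)), so the congruence [cWK] mod p suffices. *)
rewrite /pcong (_ : _ / p%:R ^+ 4 = (Wp * K p%:R - W0 * K 0) / p%:R) //.
have utermE : uterm a p.-1 = p%:R ^+ 3 * (a + 1) * Wp by apply: uterm_pred.
(* The left sum stops at k = p-2 while S_p includes k = p-1, so one term is split off each S_p. *)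
have Sp c := Ssum_recr p.-1 c; rewrite pS in Sp.
rewrite sum_div_sqr // !Sp Sterm_uterm // Sterm_succ_uterm // utermE p1.
set D := W0 * _; clearbody D Wp; rewrite /K; field.
by rewrite a0 a10 p0.
Qed.
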